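(* Let $\psi\in L^\infty(\mathbb{R})$ vanish on the negative reals, and let $\mathscr{L}\psi$ be its Laplace transform, the analytic function on the right half plane $\mathbb{C}^+=\{z\in\mathbb{C}:\mathrm{Re}\,z>0\}$ defined by $$\mathscr{L}\psi(s)=\int_{0}^{\infty}\psi(t)e^{-st}\,dt,\qquad s\in\mathbb{C}^+ .$$ If $\mathscr{L}\psi$ has $H^1$ boundary behavior at $s=0$, then $\psi$ is almost convergent to $0$.
   Context: A function $f$ on $\mathbb{C}^+$ has $H^1$ boundary behavior at $z_0=iy_0$ ($y_0\in\mathbb{R}$) if there exist $\delta>0$ and a function $F\in L^1(y_0-\delta,y_0+\delta)$ such that $f(x+iy)$ converges to $F(y)$ in $L^1(y_0-\delta,y_0+\delta)$ as $x\to0^+$. $L^\infty(\mathbb{R})$ is the space of complex-valued essentially bounded measurable functions on $\mathbb{R}$, and $(f*\psi)(x)=\int_{\mathbb{R}}f(t)\psi(x-t)\,dt$. A mean on $L^\infty(\mathbb{R})$ is $\varphi\in L^\infty(\mathbb{R})^*$ with $\varphi(\psi)\ge0$ for all $\psi\ge0$ and $\varphi(\mathbf1)=1$; it is topologically invariant if $\varphi(f*\psi)=\varphi(\psi)$ for all $\psi\in L^\infty(\mathbb{R})$ and all nonnegative $f\in L^1(\mathbb{R})$ with $\int f=1$. The function $\psi\in L^\infty(\mathbb{R})$ is almost convergent to $\alpha\in\mathbb{C}$ if $\varphi(\psi)=\alpha$ for every topologically invariant mean $\varphi$ on $L^\infty(\mathbb{R})$. *)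

(* Defs.v *)
From HB Require Import structures.
From mathcomp Require Import all_boot all_order all_algebra.
From mathcomp Require Import all_classical all_reals all_analysis.
From mathcomp Require Import complex.

Set Implicit Arguments.
Unset Strict Implicit.
Unset Printing Implicit Defensive.

Import Order.TTheory GRing.Theory Num.Theory.
Import numFieldNormedType.Exports.
Import ComplexField.Normc.

Local Open Scope classical_set_scope.
Local Open Scope ring_scope.
Local Open Scope complex_scope.

Section ComplexValued.
Context {R : realType}.
Implicit Types (D : set R) (f psi : R -> R[i]).
Local Notation mu := (@lebesgue_measure R).

Definition cexp (z : R[i]) : R[i] :=
  (expR (complex.Re z))%:C * (cos (complex.Im z) +i* sin (complex.Im z)).

Definition cmeasurable D f : Prop :=
  measurable_fun D (fun x => complex.Re (f x)) /\
  measurable_fun D (fun x => complex.Im (f x)).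

(* L^1(D); measurability on D is part of the library's [integrable]. *)
Definition cintegrable D f : Prop :=
  mu.-integrable D (fun x => (complex.Re (f x))%:E) /\
  mu.-integrable D (fun x => (complex.Im (f x))%:E).

Definition cintegral D f : R[i] :=
  (\int[mu]_(x in D) complex.Re (f x))%R +i*
  (\int[mu]_(x in D) complex.Im (f x))%R.

Definition Linfty_norm f : \bar R := Lnorm mu +oo%E (fun x => (normc (f x))%:E).

Definition Linfty f : Prop :=
  cmeasurable setT f /\ (Linfty_norm f < +oo)%E.

Definition convolution f psi : R -> R[i] :=
  fun x => cintegral setT (fun t => f t * psi (x - t)).

Definition laplace psi : R[i] -> R[i] :=
  fun s => cintegral `[0, +oo[ (fun t => psi t * cexp (- (s * t%:C))).

(* Behaviour of [f] at the boundary point [i y0]; only the values of [f] on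
   the open right half plane matter. *)
Definition H1_boundary_behavior (f : R[i] -> R[i]) (y0 : R) : Prop :=
  exists delta : R, 0 < delta /\
  let I := `]y0 - delta, y0 + delta[%classic in
  exists F : R -> R[i], cintegrable I F /\
    (\forall x \near 0^'+, cintegrable I (fun y => f (x +i* y))) /\
    (fun x => \int[mu]_(y in I) (normc (f (x +i* y) - F y))%:E)%E @ 0^'+ --> 0%E.

(* A bounded linear functional on L^oo, given on representatives.  The bound
   forces [phi] to agree on a.e. equal functions, so it descends to classes;
   its values outside [Linfty] are irrelevant. *)
Definition Linfty_dual (phi : (R -> R[i]) -> R[i]) : Prop :=
  (forall (a : R[i]) f g, Linfty f -> Linfty g ->
     phi (fun x => a * f x + g x) = a * phi f + phi g) /\
  (exists M : R, forall f, Linfty f ->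
     ((normc (phi f))%:E <= M%:E * Linfty_norm f)%E).

(* In [R[i]], [0 <= z] means that [z] is real and nonnegative. *)
Definition is_mean (phi : (R -> R[i]) -> R[i]) : Prop :=
  [/\ Linfty_dual phi,
      (forall psi, Linfty psi -> {ae mu, forall x, 0 <= psi x} ->
         0 <= phi psi)
    & phi (fun=> 1) = 1].

Definition topologically_invariant (phi : (R -> R[i]) -> R[i]) : Prop :=
  forall f psi, Linfty psi ->
    cintegrable setT f -> {ae mu, forall x, 0 <= f x} ->
    cintegral setT f = 1 ->
    phi (convolution f psi) = phi psi.

Definition almost_convergent psi (alpha : R[i]) : Prop :=
  forall phi, is_mean phi -> topologically_invariant phi -> phi psi = alpha.

End ComplexValued.

(* Main.v *)
Require Import Defs.
From mathcomp Require Import all_boot all_order all_algebra.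
From mathcomp Require Import all_classical all_reals all_analysis.
From mathcomp Require Import complex.
From mathcomp Require Import measurable_realfun ess_sup_inf ring lra.

Import Order.TTheory GRing.Theory Num.Theory.
Import numFieldNormedType.Exports.
Import ComplexField.Normc.

Local Open Scope classical_set_scope.
Local Open Scope ring_scope.
Local Open Scope complex_scope.

(** The Fejer kernel, [fejer eta t = 2 (1 - cos (eta t)) / t ^ 2] for [t <> 0], is
nonnegative and integrable, and it is the cosine transform of the triangular
window [eta - |w|], which lives on the frequencies [|w| <= eta]. Convolving
[psi] with it therefore only sees the Laplace transform of [psi] on the
segment [s + i w], [|w| <= eta], as [s] tends to [0+].

Quantitatively, let the boundary function [F] be defined on [|w| < delta], and
fix [eta < delta]. By Fubini ([fejer_convolution_le]) the convolution of
[fejer eta] with [exp (- s u) psi u] is bounded, uniformly in the point where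
it is evaluated, by a multiple of [eta] times the integral of [|laplace psi (s
+ i w)|] over [|w| <= eta]. Let [s] tend to [0+]: the left side converges by
dominated convergence ([cvg_fejer_damped]), and on the right side the H^1
behaviour replaces [laplace psi (s + i w)] by its boundary function [F w].
Hence the convolution of [psi] with [fejer eta] is at most a multiple of [eta]
times the integral of [|F|] over [|w| <= eta] ([small_fejer_mean]). The mass
of [fejer eta] is at least a constant times [eta] ([fejer_mass_ge]), so after
normalization the factor [eta] cancels and what is left is the integral of
[|F|] over a shrinking interval, which tends to [0].

So for every [eps > 0] there is a probability density [f] with [|f * psi| <=
eps] everywhere ([convolution_fejer_le]). A topologically invariant mean [phi]
has [phi psi = phi (f * psi)], and a bounded functional sends functions of
small norm to small numbers, so [phi psi = 0]. *)

Local Notation leb R := (@lebesgue_measure R).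

(** * Integration along reflected translates *)

Lemma ae_imply {R : realType} {P Q : R -> Prop} :
  {ae leb R, forall u, P u} -> (forall u, P u -> Q u) ->
  {ae leb R, forall u, Q u}.
Proof.
move=> aeP PQ.
apply: (@filterS _ _ (ae_filter_ringOfSetsType _) _ _ _ aeP) => u.
exact: PQ.
Qed.

(** Without an integrability hypothesis Fubini's theorem is not available, but
the positive and the negative part of [h] can be integrated separately by
Tonelli's theorem, and [fine] is measurable. *)
Lemma measurable_Rintegral_param {R : realType} (h : R * R -> R) :
  measurable_fun setT h ->
  measurable_fun setT (fun x => (\int[leb R]_y h (x, y))%R).
Proof.
move=> mh; have mH : measurable_fun setT (EFin \o h) by exact/measurable_EFinP.
apply: (measurableT_comp (@fine_measurable R setT measurableT)).
pose mu := leb R.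
pose p x := (\int[mu]_y (EFin \o h)^\+ (x, y))%E.
pose n x := (\int[mu]_y (EFin \o h)^\- (x, y))%E.
rewrite (_ : (fun x => _) = p \- n)%E; last first.
  apply/funext => x; rewrite [LHS]integralE.
  rewrite /p /n /=; congr (adde _ (oppe _)).
    by apply: eq_integral => y _; rewrite !(funeposE,funenegE) /=.
  by apply: eq_integral => y _; rewrite !(funeposE,funenegE) /=.
have mp : measurable_fun setT p.
  apply: (@measurable_fun_fubini_tonelli_F _ _ R (measurableTypeR R) R mu
    (funepos (EFin \o h))) => //.
  exact: measurable_funepos.
have mn : measurable_fun setT n.
  apply: (@measurable_fun_fubini_tonelli_F _ _ R (measurableTypeR R) R mu
    (funeneg (EFin \o h))) => //.
  exact: measurable_funeneg.
exact: emeasurable_funB.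
Qed.

Lemma measurable_reflect {R : realType} (x : R) :
  measurable_fun setT (fun t : R => x - t).
Proof. by apply: measurable_funB. Qed.

(** The reflection [t |-> x - t] maps half-open intervals to intervals of the
same length, and these determine Lebesgue measure. *)
Lemma pushforward_reflect {R : realType} (x : R) (A : set (measurableTypeR R)) :
  measurable A ->
  pushforward (leb R)
    ((fun t => x - t) : measurableTypeR R -> measurableTypeR R) A
  = lebesgue_measure A.
Proof.
move=> mA; apply/esym/lebesgue_measure_unique => //=.
  exact: measurable_reflect.
move=> _ _ [[a b]] _ <-; rewrite /pushforward.
rewrite (_ : _ @^-1` _ = `[x - b, x - a[%classic); last first.
  by apply/seteqP; split => t /=; rewrite !in_itv /= => /andP[? ?]; lra.
rewrite !lebesgue_measure_itv/= !lte_fin ltrD2l ltrN2.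
by case: ifP => // _; rewrite -!EFinD; congr EFin; ring.
Qed.

Lemma ge0_integral_reflect {R : realType} (x : R) (f : R -> \bar R) :
  measurable_fun setT f -> (forall t, (0 <= f t)%E) ->
  (\int[leb R]_t f (x - t)%R = \int[leb R]_t f t)%E.
Proof.
move=> mf f0.
have := @ge0_integral_pushforward _ _ _ _ R
  ((fun t => x - t) : measurableTypeR R -> measurableTypeR R)
  (measurable_reflect x) (leb R) setT f measurableT mf
  (fun y _ => f0 y).
rewrite preimage_setT /= => <-.
apply: eq_measure_integral => [|? A mA _]; first exact: measurable_reflect.
exact: pushforward_reflect.
Qed.

Lemma Rintegral_reflect {R : realType} (x : R) (f : R -> R) :
  measurable_fun setT f ->
  (\int[leb R]_t f (x - t) = \int[leb R]_t f t)%R.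
Proof.
move=> mf; have mF : measurable_fun setT (EFin \o f) by exact/measurable_EFinP.
congr fine; rewrite integralE [RHS]integralE; congr (adde _ (oppe _)).
  rewrite -[RHS](ge0_integral_reflect x) //; last exact: measurable_funepos.
  by apply: eq_integral => t _; rewrite !funeposE.
rewrite -[RHS](ge0_integral_reflect x) //; last exact: measurable_funeneg.
by apply: eq_integral => t _; rewrite !funenegE.
Qed.

Lemma integrable_reflect {R : realType} (x : R) (f : R -> R) :
  (leb R).-integrable setT (EFin \o f) ->
  (leb R).-integrable setT (fun t => (f (x - t))%:E).
Proof.
move=> /integrableP[mf foo]; apply/integrableP; split.
  exact: (measurableT_comp mf (measurable_reflect x)).
rewrite (ge0_integral_reflect x (fun t => `|(f t)%:E|%E))//.
exact: measurableT_comp.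
Qed.

(** * The Fejer kernel *)

(** Taking the Fourier integral rather than [2 (1 - cos (eta t)) / t ^ 2] as the
definition makes Fubini's theorem and the bound near [t = 0] immediate; the
closed form then holds after multiplication by [t ^ 2], including at [0]. *)
Definition fejer {R : realType} (eta t : R) : R :=
  (\int[leb R]_(w in `[0, eta]) (2 * (eta - w) * cos (w * t)))%R.

Lemma continuous_fejer_integrand {R : realType} (eta t : R) :
  continuous (fun w : R => 2 * (eta - w) * cos (w * t)).
Proof.
move=> w; apply: cvgM.
  by apply: cvgM; [exact: cvg_cst|apply: cvgB; [exact: cvg_cst|exact: cvg_id]].
apply: continuous_comp; last exact: continuous_cos.
by apply: cvgM; [exact: cvg_id|exact: cvg_cst].
Qed.

Lemma integrable_fejer_integrand {R : realType} (eta t : R) :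
  (leb R).-integrable `[0, eta]
    (fun w => (2 * (eta - w) * cos (w * t))%:E).
Proof.
apply: (@continuous_compact_integrable R (fun w =>
  2 * (eta - w) * cos (w * t))).
  exact: segment_compact.
by apply: continuous_subspaceT => w; exact: continuous_fejer_integrand.
Qed.

Lemma fejer_closed_form {R : realType} (eta t : R) : 0 < eta ->
  t ^+ 2 * fejer eta t = 2 * (1 - cos (eta * t)).
Proof.
move=> eta0; rewrite /fejer -RintegralZl//;
  last exact: integrable_fejer_integrand.
pose F w : R := 2 * (eta - w) * t * sin (w * t) - 2 * cos (w * t).
have cF : continuous F.
  move=> w; apply: cvgB.
    apply: cvgM.
      apply: cvgM; [|exact: cvg_cst].
      by apply: cvgM; [exact: cvg_cst|apply: cvgB;
        [exact: cvg_cst|exact: cvg_id]].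
    apply: continuous_comp; last exact: continuous_sin.
    by apply: cvgM; [exact: cvg_id|exact: cvg_cst].
  apply: cvgM; [exact: cvg_cst|].
  apply: continuous_comp; last exact: continuous_cos.
  by apply: cvgM; [exact: cvg_id|exact: cvg_cst].
have dF (w : R) : is_derive w 1 F (t ^+ 2 * (2 * (eta - w) * cos (w * t))).
  rewrite /F; apply: is_derive_eq.
  rewrite /GRing.scale /=. ring.
rewrite /Rintegral (@continuous_FTC2 _ _ F)//=.
- by rewrite /F subrr subr0 !mul0r mulr0 cos0 sin0; ring.
- apply: continuous_subspaceT => w.
  by apply: cvgM; [exact: cvg_cst|exact: continuous_fejer_integrand].
- split.
  + by move=> w _; apply: ex_derive.
  + by apply: cvg_at_right_filter; exact: cF.
  + by apply: cvg_at_left_filter; exact: cF.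
- by move=> w _; rewrite derive1E; exact: derive_val.
Qed.

Lemma fejer_le {R : realType} (eta t : R) : 0 < eta ->
  `|fejer eta t| <= 2 * eta ^+ 2.
Proof.
move=> eta0; apply: (le_trans (le_normr_Rintegral _ (integrable_fejer_integrand
  eta t))) => //.
apply: (@le_trans _ _ (\int[leb R]_(w in `[0%R, eta]) (2 * eta))%R).
  apply: le_Rintegral => //.
  - exact: integrable_norm (integrable_fejer_integrand eta t).
  - apply: (@continuous_compact_integrable R (fun=> 2 * eta)).
      exact: segment_compact.
    by apply: continuous_subspaceT => w; exact: cvg_cst.
  - move=> w /=; rewrite in_itv/= => /andP[w0 weta].
    rewrite !normrM (ger0_norm (_ : 0 <= eta - w)) ?subr_ge0// ger0_norm//.
    by have := cos_max (w * t); nra.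
rewrite Rintegral_cst//= [X in fine X]lebesgue_measure_itv/= lte_fin eta0/=
  oppr0 addr0.
by rewrite -mulrA -expr2.
Qed.

Lemma fejer_ge0 {R : realType} (eta t : R) : 0 < eta -> 0 <= fejer eta t.
Proof.
move=> eta0; have [->|t0] := eqVneq t 0.
  apply: Rintegral_ge0 => w /=; rewrite in_itv/= mulr0 cos0 => /andP[w0 weta].
  by rewrite mulr1 mulr_ge0// subr_ge0.
have t2 : 0 < t ^+ 2 by rewrite exprn_even_gt0.
by rewrite -(pmulr_rge0 _ t2) fejer_closed_form// mulr_ge0// subr_ge0 cos_le1.
Qed.

Lemma measurable_fejer {R : realType} (eta : R) :
  measurable_fun setT (fejer eta).
Proof.
pose h z : R :=
  \1_(`[0, eta] : set R) z.2 * (2 * (eta - z.2) * cos (z.2 * z.1)).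
rewrite (_ : fejer eta = fun t => (\int[leb R]_w h (t, w))%R).
  apply: measurable_Rintegral_param.
  apply: measurable_funM.
    by apply: measurableT_comp => //; exact: measurable_indic.
  apply: measurable_funM.
    by apply: measurable_funM => //; apply: measurable_funB.
  apply: measurableT_comp; last by apply: measurable_funM.
  by apply: continuous_measurable_fun; exact: continuous_cos.
apply/funext => t; rewrite /fejer Rintegral_mkcond; apply: eq_Rintegral => w _.
by rewrite /h patchE indicE/=; case: ifP; rewrite ?mul1r ?mul0r.
Qed.

(** Adds the bound [2 eta ^ 2] coming from the integral to the bound [4] on
[t ^ 2 * fejer eta t] coming from the closed form. *)
Lemma fejer_le_oneDsqr {R : realType} (eta t : R) : 0 < eta ->
  fejer eta t <= (2 * eta ^+ 2 + 4) * (oneDsqr t)^-1.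
Proof.
move=> eta0; rewrite ler_pdivlMr ?oneDsqr_gt0// /oneDsqr.
rewrite mulrDr mulr1 (mulrC _ (t ^+ 2)) fejer_closed_form//.
have := cos_geN1 (eta * t); have := fejer_le eta t eta0.
by rewrite ger0_norm ?fejer_ge0//; lra.
Qed.

Lemma integrable_oneDsqrV {R : realType} :
  (leb R).-integrable setT (fun t => (oneDsqr t)^-1%:E).
Proof.
have mV : measurable_fun setT (fun t : R => (oneDsqr t)^-1%:E).
  apply/measurable_EFinP; apply: continuous_measurable_fun.
  exact: continuous_oneDsqrV.
have pos (t : R) : (0 <= ((oneDsqr t)^-1)%:E)%E by rewrite lee_fin invr_ge0//
  /oneDsqr; nra.
apply/integrableP; split => //.
under eq_integral do rewrite gee0_abs//.
have h : (\int[leb R]_(t in `[0%R, +oo[) (oneDsqr t)^-1%:E < +oo)%E.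
  by rewrite integral0y_oneDsqr ltry.
rewrite -(itv_setU_setT true (0 : R)) ge0_integral_setU//=; first last.
- apply/disj_setPS => t /= []; rewrite !in_itv/= andbT => t0 t1.
  by move: (lt_le_trans t0 t1); rewrite ltxx.
- exact: measurable_funTS.
rewrite lte_add_pinfty//.
have := @ge0_integration_by_substitution0 R (fun t => (oneDsqr t)^-1%:E) mV pos.
under [X in _ = X -> _]eq_integral do rewrite /oneDsqr sqrrN.
move=> E; apply: le_lt_trans h; rewrite E.
apply: ge0_subset_integral => //; first exact: measurable_funTS.
by apply: subset_itvl; rewrite bnd_simp.
Qed.

Lemma integrable_fejer {R : realType} (eta : R) : 0 < eta ->
  (leb R).-integrable setT (EFin \o fejer eta).
Proof.
move=> eta0.
pose g (t : R) := ((2 * eta ^+ 2 + 4)%:E * (oneDsqr t)^-1%:E)%E.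
apply: (@le_integrable _ (measurableTypeR R) R (leb R) setT
  measurableT (EFin \o fejer eta) g).
- by apply/measurable_EFinP; exact: measurable_fejer.
- move=> t _ /=; rewrite lee_fin ger0_norm ?fejer_ge0// (le_trans
    (fejer_le_oneDsqr _ _ eta0))//.
  exact: ler_norm.
- exact: integrableZl integrable_oneDsqrV.
Qed.

(** On [[1 / eta, 2 / eta]] the angle [eta t] lies in [[1, 2]], so the kernel is
at least [eta ^ 2 (1 - cos 1) / 2] there, on an interval of length [1 / eta].
Only the linear growth in [eta] matters, not the exact mass. *)
Lemma fejer_mass_ge {R : realType} (eta : R) : 0 < eta ->
  eta * ((1 - cos 1) / 2) <= (\int[leb R]_t fejer eta t)%R.
Proof.
move=> eta0.
pose J := `[eta^-1, 2 * eta^-1]%classic.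
have ie : 0 < eta^-1 by rewrite invr_gt0.
have mJ : lebesgue_measure J = (eta^-1)%:E.
  rewrite lebesgue_measure_itv/= lte_fin ifT; last by lra.
  by rewrite -EFinD; congr EFin; ring.
have iK := integrable_fejer _ eta0.
apply: (@le_trans _ _ (\int[leb R]_(t in J) fejer eta t)%R).
  have -> : eta * ((1 - cos 1) / 2) =
    (\int[leb R]_(t in J) (eta ^+ 2 * ((1 - cos 1) / 2)))%R.
    rewrite Rintegral_cst; last exact: measurable_itv.
    rewrite [fine _](_ : _ = eta^-1); last exact: (congr1 fine mJ).
    by field; rewrite gt_eqF.
  rewrite /J; apply: le_Rintegral => //.
  - apply: (@continuous_compact_integrable R (fun=> eta ^+ 2 * ((1 - cos 1) /
      2))).
      exact: segment_compact.
    by apply: continuous_subspaceT => w; exact: cvg_cst.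
  - by apply: integrableS iK.
  - move=> t; rewrite /= in_itv/= => /andP[t1 t2].
    have t0 : 0 < t by exact: lt_le_trans t1.
    have s1 : 1 <= eta * t by rewrite -(mulfV (lt0r_neq0 eta0)) ler_pM2l.
    have s2 : eta * t <= 2.
      by rewrite -[2](mulfVK (lt0r_neq0 eta0)) [leRHS]mulrC ler_pM2l.
    have pi2 := @pi_ge2 R.
    have c1 : cos (eta * t) <= cos 1.
      by rewrite leNgt ltr_cos ?in_itv/=; [rewrite -leNgt| |]; lra.
    rewrite -(@ler_pM2l _ (t ^+ 2)) ?exprn_gt0// fejer_closed_form//.
    rewrite mulrA -exprMn (mulrC t).
    have s4 : (eta * t) ^+ 2 <= 4 by nra.
    have c0 : 0 <= 1 - cos 1 :> R by rewrite subr_ge0 cos_le1.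
    by have : (eta * t) ^+ 2 * (1 - cos 1) <= 4 * (1 - cos 1) :=
      ler_wpM2r c0 s4; lra.
rewrite /Rintegral fine_le//.
- apply: integrable_fin_num; first exact: measurable_itv.
  by apply: integrableS iK => //; exact: measurable_itv.
- by apply: integrable_fin_num.
apply: ge0_subset_integral => //.
- exact: measurable_itv.
- by apply/measurable_EFinP; exact: measurable_fejer.
- by move=> t _; rewrite lee_fin fejer_ge0.
Qed.

Lemma fejer_mass_const_gt0 {R : realType} : 0 < (1 - cos 1) / 2 :> R.
Proof.
rewrite divr_gt0// subr_gt0 -[ltRHS]cos0 ltr_cos ?in_itv/=//;
  have := @pi_ge2 R; lra.
Qed.

(** * Convolution with the Fejer kernel in terms of Fourier transforms *)

Definition cos_transform {R : realType} (q : R -> R) (w : R) : R :=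
  (\int[leb R]_u (cos (w * u) * q u))%R.

Definition sin_transform {R : realType} (q : R -> R) (w : R) : R :=
  (\int[leb R]_u (sin (w * u) * q u))%R.

Lemma integrable_bounded_mul {R : realType} (D : set R) (h q : R -> R) (M : R) :
  measurable D -> measurable_fun D h -> (forall u, D u -> `|h u| <= M) ->
  (leb R).-integrable D (EFin \o q) ->
  (leb R).-integrable D (fun u => (h u * q u)%:E).
Proof.
move=> mD mh hM iq.
have := @integrableMr _ (measurableTypeR R) R (leb R) D mD h (EFin \o q) mh _
  iq.
apply.
exists M; split; first exact: num_real.
by move=> y My u Du; rewrite /= (le_trans (hM _ Du))// ltW.
Qed.

Lemma measurable_cosM {R : realType} (w : R) :
  measurable_fun setT (fun u : R => cos (w * u)).
Proof.
apply: (measurableT_comp (continuous_measurable_fun (@continuous_cos R))).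
exact: measurable_funM.
Qed.

Lemma measurable_sinM {R : realType} (w : R) :
  measurable_fun setT (fun u : R => sin (w * u)).
Proof.
apply: (measurableT_comp (continuous_measurable_fun (@continuous_sin R))).
exact: measurable_funM.
Qed.

Lemma cos_norm_le1 {R : realType} (t : R) : `|cos t| <= 1.
Proof. by rewrite ler_norml cos_geN1 cos_le1. Qed.

Lemma sin_norm_le1 {R : realType} (t : R) : `|sin t| <= 1.
Proof. by rewrite ler_norml sin_geN1 sin_le1. Qed.

Lemma integrable_cosM {R : realType} (q : R -> R) (w : R) :
  (leb R).-integrable setT (EFin \o q) ->
  (leb R).-integrable setT (fun u => (cos (w * u) * q u)%:E).
Proof.
apply: (@integrable_bounded_mul R setT _ q 1) => //;
  first exact: measurable_cosM.
by move=> u _; exact: cos_norm_le1.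
Qed.

Lemma integrable_sinM {R : realType} (q : R -> R) (w : R) :
  (leb R).-integrable setT (EFin \o q) ->
  (leb R).-integrable setT (fun u => (sin (w * u) * q u)%:E).
Proof.
apply: (@integrable_bounded_mul R setT _ q 1) => //;
  first exact: measurable_sinM.
by move=> u _; exact: sin_norm_le1.
Qed.

Lemma measurable_cos_transform {R : realType} (q : R -> R) :
  measurable_fun setT q -> measurable_fun setT (cos_transform q).
Proof.
move=> mq; apply: (@measurable_Rintegral_param R (fun z =>
  cos (z.1 * z.2) * q z.2)).
apply: measurable_funM; last by apply: (measurableT_comp mq).
apply: (measurableT_comp (continuous_measurable_fun (@continuous_cos R))).
exact: measurable_funM.
Qed.

Lemma measurable_sin_transform {R : realType} (q : R -> R) :
  measurable_fun setT q -> measurable_fun setT (sin_transform q).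
Proof.
move=> mq; apply: (@measurable_Rintegral_param R (fun z =>
  sin (z.1 * z.2) * q z.2)).
apply: measurable_funM; last by apply: (measurableT_comp mq).
apply: (measurableT_comp (continuous_measurable_fun (@continuous_sin R))).
exact: measurable_funM.
Qed.

Lemma Rintegral_cos_reflect {R : realType} (q : R -> R) (w x : R) :
  (leb R).-integrable setT (EFin \o q) ->
  (\int[leb R]_u (cos (w * (x - u)) * q u))%R =
  cos (w * x) * cos_transform q w + sin (w * x) * sin_transform q w.
Proof.
move=> iq; rewrite /cos_transform /sin_transform.
rewrite -RintegralZl//; last exact: integrable_cosM.
rewrite -RintegralZl//; last exact: integrable_sinM.
rewrite -RintegralD//.
- by apply: eq_Rintegral => u _; rewrite mulrBr cosB mulrDl !mulrA.
- exact: (integrableZl measurableT (cos (w * x)) (integrable_cosM q w iq)).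
- exact: (integrableZl measurableT (sin (w * x)) (integrable_sinM q w iq)).
Qed.

(** Fubini's theorem exchanges the integral over [u] with the integral over the
frequency [w] that defines the kernel. At each frequency the inner integral is
a combination of the two transforms of [q] with coefficients bounded by [1], and
the window [2 (eta - w)] is at most [2 eta]. *)
Lemma fejer_convolution_le {R : realType} (eta x : R) (q : R -> R) : 0 < eta ->
  (leb R).-integrable setT (EFin \o q) ->
  (`| \int[leb R]_u (fejer eta (x - u) * q u) |%R%:E <=
   (2 * eta)%:E * \int[leb R]_(w in `[0%R, eta])
     (`|cos_transform q w| + `|sin_transform q w|)%:E)%E.
Proof.
move=> eta0 iq.
pose mu := leb R.
have mq : measurable_fun setT q by apply/measurable_EFinP;
  exact: (measurable_int mu iq).
pose g (w : R) : R := \1_(`[0, eta]%classic : set R) w * (2 * (eta - w)).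
have mg : measurable_fun setT g.
  apply: measurable_funM; first exact: measurable_indic.
  by apply: measurable_funM => //; exact: measurable_funB.
have g0 w : 0 <= g w.
  rewrite /g indicE mem_setE in_itv/=;
    case: (boolP (0 <= w <= eta)) => [/andP[w0 w1]|_]; rewrite /= ?mul0r//.
  by rewrite mul1r mulr_ge0// subr_ge0.
have gle w : g w <= \1_(`[0, eta]%classic : set R) w * (2 * eta).
  rewrite /g indicE mem_setE in_itv/=;
    case: (boolP (0 <= w <= eta)) => [/andP[w0 w1]|_]; rewrite /= ?mul0r//.
  by rewrite !mul1r ler_pM2l// gerBl.
pose Phi (z : R * R) : R := g z.1 * (cos (z.1 * (x - z.2)) * q z.2).
have mPhi : measurable_fun setT (EFin \o Phi).
  apply/measurable_EFinP; apply: measurable_funM;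
    first by apply: (measurableT_comp mg).
  apply: measurable_funM; last by apply: (measurableT_comp mq).
  apply: (measurableT_comp (continuous_measurable_fun (@continuous_cos R))).
  by apply: measurable_funM => //; exact: measurable_funB.
have mabs : measurable_fun setT (fun u : R => `|(q u)%:E|%E).
  exact: measurableT_comp (measurable_int mu iq).
have iPhi : (mu \x mu)%E.-integrable setT (EFin \o Phi).
  apply/(@integrable12ltyP _ _ (measurableTypeR R) (measurableTypeR R) R mu mu
    (EFin \o Phi) mPhi).
  apply: (@le_lt_trans _ _ (\int[mu]_w
    ((\1_(`[0%R, eta]%classic : set R) w)%:E *
     ((2 * eta)%:E * \int[mu]_u `|(q u)%:E|)))%E).
    apply: ge0_le_integral => //.
    - by move=> w _; apply: integral_ge0.
    - apply: (@measurable_fun_fubini_tonelli_F _ _ (measurableTypeR R)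
        (measurableTypeR R) R mu
        (fun z => `|(EFin \o Phi) z|%E)) => //.
      exact: measurableT_comp.
    - apply: emeasurable_funM => //; apply/measurable_EFinP;
        exact: measurable_indic.
    - move=> w _.
      rewrite muleA -ge0_integralZl//;
        last by rewrite -EFinM lee_fin mulr_ge0// ltW// mulr_gt0.
      apply: ge0_le_integral => //.
      + apply: measurableT_comp => //;
          exact: measurableT_comp mPhi (pair1_measurable _).
      + exact: emeasurable_funM.
      + move=> u _.
        rewrite /= -EFinM lee_fin normrM ger0_norm// normrM.
        rewrite mulrA ler_wpM2r// (le_trans _ (gle w))//.
        by rewrite ler_piMr// cos_norm_le1.
  have qoo : (\int[mu]_u `|(q u)%:E| < +oo)%E by case/integrableP : iq.
  have q0 : (0 <= \int[mu]_u `|(q u)%:E|)%E by exact: integral_ge0.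
  rewrite ge0_integralZr//; last 2 first.
  - by apply/measurable_EFinP; exact: measurable_indic.
  - by rewrite mule_ge0// lee_fin mulr_ge0// ltW.
  rewrite integral_indic// setIT.
  rewrite [X in (X * _)%E](_ : _ = eta%:E); last first.
    by rewrite -[eta in RHS]subr0 [LHS]lebesgue_measure_itv/= lte_fin eta0
      -EFinB.
  rewrite -(@fineK _ (\int[mu]_u `|(q u)%:E|)%E) ?ge0_fin_numE//.
  by rewrite -!EFinM ltry.
have ifj : mu.-integrable setT (fun u => (fejer eta (x - u) * q u)%:E).
  apply: (@integrable_bounded_mul R setT _ q (2 * eta ^+ 2)) => //.
  - exact: (measurableT_comp (measurable_fejer eta) (measurable_reflect x)).
  - by move=> u _; exact: fejer_le.
have Fu u : (\int[mu]_w (Phi (w, u))%:E = (fejer eta (x - u) * q u)%:E)%E.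
  rewrite /fejer -RintegralZr//; last exact: integrable_fejer_integrand.
  have iw : mu.-integrable `[0, eta]
      (fun w => (2 * (eta - w) * cos (w * (x - u)) * q u)%:E).
    exact: (integrableZr _ (q u) (integrable_fejer_integrand eta (x - u))).
  rewrite /Rintegral fineK; last exact: integrable_fin_num.
  rewrite [RHS]integral_mkcond; apply: eq_integral => w _.
  rewrite /Phi/= /g patchE indicE.
  by case: ifP; rewrite ?(mul0r,mul1r)// mulrA.
have Fw w : (\int[mu]_u (Phi (w, u))%:E =
    (g w * (cos (w * x) * cos_transform q w +
      sin (w * x) * sin_transform q w))%:E)%E.
  have iw : mu.-integrable setT (fun u => (cos (w * (x - u)) * q u)%:E).
    apply: (@integrable_bounded_mul R setT _ q 1) => //.
      exact: (measurableT_comp (measurable_cosM w) (measurable_reflect x)).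
    by move=> u _; exact: cos_norm_le1.
  rewrite -Rintegral_cos_reflect// -RintegralZl//.
  rewrite /Rintegral fineK// integrable_fin_num//.
  exact: (integrableZl measurableT (g w) iw).
rewrite EFin_normr_Rintegral//.
under eq_integral do rewrite -Fu.
rewrite -(Fubini iPhi) /=.
under eq_integral do rewrite Fw.
have mCS : measurable_fun setT (fun w =>
  (`|cos_transform q w| + `|sin_transform q w|)%:E).
  apply/measurable_EFinP; apply: measurable_funD; apply: measurableT_comp => //.
    exact: measurable_cos_transform.
  exact: measurable_sin_transform.
have mcomb : measurable_fun setT
    (fun w => (g w * (cos (w * x) * cos_transform q w +
      sin (w * x) * sin_transform q w))%:E).
  apply/measurable_EFinP; apply: measurable_funM => //; apply: measurable_funD.
    apply: measurable_funM; last exact: measurable_cos_transform.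
    by under eq_fun do rewrite mulrC; exact: measurable_cosM.
  apply: measurable_funM; last exact: measurable_sin_transform.
  by under eq_fun do rewrite mulrC; exact: measurable_sinM.
apply: (le_trans (le_abse_integral mu measurableT mcomb)).
rewrite -ge0_integralZl//; last 2 first.
- exact: measurable_funTS.
- by rewrite lee_fin mulr_ge0// ltW.
rewrite [leRHS]integral_mkcond; apply: ge0_le_integral => //.
- exact: measurableT_comp.
- apply/(measurable_restrictT _ _).1 => //; apply: measurable_funTS.
  exact: emeasurable_funM.
move=> w _; rewrite patchE /=.
have [wI|wI] := boolP (w \in `[0, eta]%classic); last first.
  by rewrite /g indicE (negbTE wI) !mul0r normr0.
rewrite -EFinM lee_fin normrM ler_pM// ?(ger0_norm (g0 w)).
  by rewrite (le_trans (gle w))// indicE wI mul1r.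
rewrite (le_trans (ler_normD _ _))// lerD// normrM ler_piMl//.
  exact: cos_norm_le1.
exact: sin_norm_le1.
Qed.

(** * Exponential damping and its removal *)

(** For [s > 0] this is the integrable function whose Fourier transform is the
Laplace transform of [a] on the line of abscissa [s]; for [s = 0] it is the
restriction of [a] to the half line. *)
Definition damped {R : realType} (a : R -> R) (s u : R) : R :=
  \1_(`[0, +oo[%classic : set R) u * (expR (- (s * u)) * a u).

Lemma measurable_damped {R : realType} (a : R -> R) (s : R) :
  measurable_fun setT a -> measurable_fun setT (damped a s).
Proof.
move=> ma; apply: measurable_funM; first exact: measurable_indic.
apply: measurable_funM => //.
apply: measurableT_comp => //.
by apply: measurableT_comp => //; exact: measurable_funM.
Qed.

Lemma normr_damped_le {R : realType} (a : R -> R) (s u : R) : 0 <= s ->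
  `|damped a s u| <= `|a u|.
Proof.
move=> s0; rewrite /damped indicE mem_setE in_itv/= andbT.
case: (boolP (0 <= u)) => [u0|_]; last by rewrite mul0r normr0.
rewrite mul1r normrM ler_piMl// ger0_norm ?expR_ge0//.
by rewrite -expR0 ler_expR oppr_le0 mulr_ge0.
Qed.

Lemma integrable_ae_bounded_mul {R : realType} (h a : R -> R) (M : R) :
  (leb R).-integrable setT (EFin \o h) ->
  measurable_fun setT a ->
  {ae leb R, forall u, `|a u| <= M} ->
  (leb R).-integrable setT (fun u => (h u * a u)%:E).
Proof.
move=> ih ma aM.
have mh : measurable_fun setT h by apply/measurable_EFinP;
  exact: (measurable_int _ ih).
apply/integrableP; split; first by apply/measurable_EFinP;
  exact: measurable_funM.
have iMh : (leb R).-integrable setT (fun u => (`|M| * h u)%:E).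
  exact: (integrableZl measurableT `|M| ih).
have /integrableP[mMh] := iMh; apply: le_lt_trans.
apply: ae_ge0_le_integral => //.
- by apply: measurableT_comp => //; apply/measurable_EFinP;
    exact: measurable_funM.
- by apply: measurableT_comp => //; apply/measurable_EFinP;
    exact: measurable_funM.
apply: (ae_imply aM) => u uM _; rewrite /= lee_fin !normrM normr_id mulrC.
by rewrite ler_wpM2r// (le_trans uM)// ler_norm.
Qed.

(** Up to the factor [s] the damping factor is the exponential density. *)
Lemma integrable_damped {R : realType} (a : R -> R) (M s : R) : 0 < s ->
  measurable_fun setT a ->
  {ae leb R, forall u, `|a u| <= M} ->
  (leb R).-integrable setT (EFin \o damped a s).
Proof.
move=> s0 ma aM.
have ip := integrable_exponential_pdf s0.
have := integrable_ae_bounded_mul _ _ _ (integrableZl measurableT s^-1 ip) ma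
  aM.
apply: eq_integrable => // u _;
  rewrite /damped /= /exponential_pdf patchE indicE.
case: ifP => _; last by rewrite mulr0 !mul0r.
by rewrite mul1r mulrA mulVf ?gt_eqF// mul1r mulNr.
Qed.

(** The integrands are all dominated by the integrable kernel times an essential
bound of [a]. *)
Lemma cvg_fejer_damped {R : realType} (a : R -> R) (M eta x : R)
    (s : nat -> R) :
  0 < eta -> (forall n, 0 < s n) -> s n @[n --> \oo] --> 0 ->
  measurable_fun setT a ->
  {ae leb R, forall u, `|a u| <= M} ->
  (\int[leb R]_u (fejer eta (x - u) * damped a (s n) u))%R
    @[n --> \oo] -->
  (\int[leb R]_u (fejer eta (x - u) * damped a 0 u))%R.
Proof.
move=> eta0 s0 scvg ma aM; pose mu := leb R.
have mK : measurable_fun setT (fun u : R => fejer eta (x - u)).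
  exact: (measurableT_comp (measurable_fejer eta) (measurable_reflect x)).
have iK := integrable_reflect x _ (integrable_fejer _ eta0).
have mf n : measurable_fun setT (fun u : R =>
  (fejer eta (x - u) * damped a (s n) u)%:E).
  by apply/measurable_EFinP; apply: measurable_funM => //;
    exact: measurable_damped.
have mf0 : measurable_fun setT (fun u : R =>
  (fejer eta (x - u) * damped a 0 u)%:E).
  by apply/measurable_EFinP; apply: measurable_funM => //;
    exact: measurable_damped.
have iM : mu.-integrable setT (fun u : R => (fejer eta (x - u) * `|M|)%:E).
  exact: (integrableZr measurableT `|M| iK).
have bnd t u : 0 <= t -> `|a u| <= M ->
  `|fejer eta (x - u) * damped a t u| <= fejer eta (x - u) * `|M|.
  move=> t0 uM; rewrite normrM ger0_norm ?fejer_ge0// ler_wpM2l ?fejer_ge0//.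
  by rewrite (le_trans (normr_damped_le a t u t0))// (le_trans uM)// ler_norm.
have [] := @dominated_convergence _ _ R mu setT measurableT _ _ _ mf mf0 _ iM _.
- apply: nearW => u _; apply: cvg_EFin; first by apply: nearW.
  apply: cvgM; first exact: cvg_cst.
  apply: cvgM; first exact: cvg_cst.
  apply: cvgM; last exact: cvg_cst.
  apply: continuous_cvg; first exact: continuous_expR.
  by apply: cvgN; apply: cvgM; [exact: scvg|exact: cvg_cst].
- by apply: (ae_imply aM) => u uM n _; rewrite lee_fin bnd// ltW.
move=> i0 _.
rewrite /= -(@fineK _ (integral _ _ _)); last by apply: integrable_fin_num.
by move=> /fine_cvgP[_].
Qed.

(** * The Laplace transform and the damped Fourier transforms *)

Lemma Re_laplace {R : realType} (psi : R -> R[i]) (s w : R) :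
  let a := damped (fun u => complex.Re (psi u)) s in
  let b := damped (fun u => complex.Im (psi u)) s in
  (leb R).-integrable setT (EFin \o a) ->
  (leb R).-integrable setT (EFin \o b) ->
  complex.Re (laplace psi (s +i* w)) = cos_transform a w + sin_transform b w.
Proof.
move=> a b ia ib.
rewrite /cos_transform /sin_transform -RintegralD//; last 2 first.
- exact: integrable_cosM.
- exact: integrable_sinM.
rewrite /laplace /cintegral /= Rintegral_mkcond; apply: eq_Rintegral => u _.
rewrite patchE /a /b /damped indicE; case: ifP => _;
  last by rewrite !(mul0r,mulr0) addr0.
rewrite /cexp /=; case: (psi u) => p q /=.
rewrite !(mul0r, mulr0, subr0, addr0, add0r, mul1r, sub0r) cosN sinN.
by ring.
Qed.

Lemma Im_laplace {R : realType} (psi : R -> R[i]) (s w : R) :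
  let a := damped (fun u => complex.Re (psi u)) s in
  let b := damped (fun u => complex.Im (psi u)) s in
  (leb R).-integrable setT (EFin \o a) ->
  (leb R).-integrable setT (EFin \o b) ->
  complex.Im (laplace psi (s +i* w)) = cos_transform b w - sin_transform a w.
Proof.
move=> a b ia ib.
rewrite /cos_transform /sin_transform -RintegralB//; last 2 first.
- exact: integrable_cosM.
- exact: integrable_sinM.
rewrite /laplace /cintegral /= Rintegral_mkcond; apply: eq_Rintegral => u _.
rewrite patchE /a /b /damped indicE; case: ifP => _;
  last by rewrite !(mul0r,mulr0) subr0.
rewrite /cexp /=; case: (psi u) => p q /=.
rewrite !(mul0r, mulr0, subr0, addr0, add0r, mul1r, sub0r) cosN sinN.
by ring.
Qed.

Lemma cos_transformN {R : realType} (q : R -> R) (w : R) :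
  cos_transform q (- w) = cos_transform q w.
Proof. by apply: eq_Rintegral => u _; rewrite mulNr cosN. Qed.

Lemma sin_transformN {R : realType} (q : R -> R) (w : R) :
  (leb R).-integrable setT (EFin \o q) ->
  sin_transform q (- w) = - sin_transform q w.
Proof.
move=> iq; rewrite -[RHS]mulN1r /sin_transform -RintegralZl//;
  last exact: integrable_sinM.
by apply: eq_Rintegral => u _; rewrite mulNr sinN mulN1r mulNr.
Qed.

(** Measures complex numbers by the sum norm, which splits over real and imaginary
parts as [cintegral] does; it is equivalent to the modulus. *)
Definition norm1 {R : realType} (z : R[i]) : R :=
  `|complex.Re z| + `|complex.Im z|.

Lemma norm1_ge0 {R : realType} (z : R[i]) : 0 <= norm1 z.
Proof. by rewrite addr_ge0. Qed.

Lemma norm1D {R : realType} (z t : R[i]) : norm1 (z + t) <= norm1 z + norm1 t.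
Proof.
rewrite /norm1; case: z => a b; case: t => c d /=.
by rewrite addrACA lerD// ler_normD.
Qed.

Lemma norm1_le_normc {R : realType} (z : R[i]) : norm1 z <= 2 * normc z.
Proof.
rewrite /norm1; case: z => a b /=;
  rewrite mulrDl !mul1r lerD// -sqrtr_sqr ler_sqrt//.
all: by rewrite ?addr_ge0 ?sqr_ge0// ?lerDl ?lerDr sqr_ge0.
Qed.

Lemma normc_le_norm1 {R : realType} (z : R[i]) : normc z <= norm1 z.
Proof.
rewrite /norm1; case: z => a b /=.
rewrite -[leRHS]ger0_norm ?addr_ge0// -sqrtr_sqr ler_sqrt ?sqr_ge0//.
rewrite sqrrD !real_normK ?num_real// lerD2r lerDl mulrn_wge0// mulr_ge0//.
Qed.

(** The Laplace transform at [s + i w] and [s - i w] mixes the transforms of the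
real and the imaginary part of [psi]. Adding and subtracting the two values, using
the parity of the cosine and sine transforms, isolates each of the four
transforms; this is why the frequencies [w] and [- w] both appear. *)
Lemma cos_sin_transform_le_laplace {R : realType} (psi : R -> R[i]) (s w : R) :
  let a := damped (fun u => complex.Re (psi u)) s in
  let b := damped (fun u => complex.Im (psi u)) s in
  (leb R).-integrable setT (EFin \o a) ->
  (leb R).-integrable setT (EFin \o b) ->
  let N := 2^-1 * (norm1 (laplace psi (s +i* w)) +
    norm1 (laplace psi (s +i* (- w)))) in
  `|cos_transform a w| + `|sin_transform a w| <= N /\
    `|cos_transform b w| + `|sin_transform b w| <= N.
Proof.
move=> a b ia ib N; rewrite /N /norm1 !Re_laplace// !Im_laplace//
  !cos_transformN !sin_transformN//.
rewrite -/a -/b; set p := cos_transform a w; set q := sin_transform a w;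
  set r := cos_transform b w; set t := sin_transform b w.
have hl (x y : R) : `|x| <= 2^-1 * (`|x + y| + `|x - y|).
  have := ler_normD (x + y) (x - y).
  by rewrite (_ : x + y + (x - y) = 2 * x) ?normrM ?normr_nat; lra.
have hr (x y : R) : `|y| <= 2^-1 * (`|x + y| + `|x - y|).
  have := ler_normB (x + y) (x - y).
  by rewrite (_ : x + y - (x - y) = 2 * y) ?normrM ?normr_nat; lra.
have hpt := hl p t; have hqr := hr r q; have hrq := hl r q; have htp := hr p t.
by rewrite !opprK; split; lra.
Qed.

(** * Essential bounds, measurability and symmetrization *)

Lemma Linfty_norm_le {R : realType} (g : R -> R[i]) (C : R) :
  0 <= C -> (forall x, normc (g x) <= C) -> (Linfty_norm g <= C%:E)%E.
Proof.
move=> C0 gC; rewrite /Linfty_norm unlock; case: ifP => _;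
  last by rewrite lee_fin.
apply/ess_supP; apply: nearW => x /=; rewrite lee_fin ger0_norm// ?gC//.
by case: (g x) => ? ? /=; rewrite sqrtr_ge0.
Qed.

Lemma Linfty_norm_ge0 {R : realType} (g : R -> R[i]) : (0 <= Linfty_norm g)%E.
Proof. exact: Lnorm_ge0. Qed.

Lemma normr_Re_le_normc {R : realType} (z : R[i]) :
  `|complex.Re z| <= normc z.
Proof.
case: z => a b /=; rewrite -sqrtr_sqr ler_sqrt ?lerDl ?sqr_ge0//.
by rewrite addr_ge0 ?sqr_ge0.
Qed.

Lemma normr_Im_le_normc {R : realType} (z : R[i]) :
  `|complex.Im z| <= normc z.
Proof.
case: z => a b /=; rewrite -sqrtr_sqr ler_sqrt ?lerDr ?sqr_ge0//.
by rewrite addr_ge0 ?sqr_ge0.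
Qed.

Lemma Linfty_bound {R : realType} (psi : R -> R[i]) : Linfty psi ->
  exists M : R, {ae leb R, forall u, normc (psi u) <= M}.
Proof.
case=> _; rewrite /Linfty_norm unlock ifT; last first.
  have : (0 < leb R [set` `]-oo, +oo[%R])%E.
    by rewrite lebesgue_measure_itv/= addye// ltry.
  by rewrite set_itvNyy.
move=> H; move: H (ess_sup_ge (leb R)
  (abse \o (fun x => (normc (psi x))%:E))).
case: (ess_sup _ _) => [r| |]//= _ hr.
- exists r; apply: (ae_imply hr) => u.
  by rewrite lee_fin; apply: le_trans; exact: ler_norm.
- by exists 0; apply: (ae_imply hr) => u.
Qed.

Lemma measurable_normc {R : realType} (D : set R) (f : R -> R[i]) :
  cmeasurable D f -> measurable_fun D (fun x => normc (f x)).
Proof.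
case=> mr mi.
rewrite (_ : (fun x => _) = (fun x =>
  Num.sqrt (complex.Re (f x) ^+ 2 + complex.Im (f x) ^+ 2))).
  apply: (measurableT_comp (continuous_measurable_fun (@sqrt_continuous R))).
  by apply: measurable_funD; apply: measurable_funX.
by apply/funext => x; case: (f x).
Qed.

Lemma measurable_norm1 {R : realType} (D : set R) (f : R -> R[i]) :
  cmeasurable D f -> measurable_fun D (fun x => norm1 (f x)).
Proof.
by case=> mr mi; apply: measurable_funD; apply: measurableT_comp.
Qed.

Lemma cmeasurable_laplace {R : realType} (psi : R -> R[i]) (s : R) :
  (leb R).-integrable setT (EFin \o damped (fun u => complex.Re (psi u)) s) ->
  (leb R).-integrable setT (EFin \o damped (fun u => complex.Im (psi u)) s) ->
  cmeasurable setT (fun w => laplace psi (s +i* w)).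
Proof.
move=> ia ib.
have ma := (measurable_EFinP _ _).1 (measurable_int _ ia).
have mb := (measurable_EFinP _ _).1 (measurable_int _ ib).
split.
  under eq_fun do rewrite Re_laplace//.
  by apply: measurable_funD; [exact: measurable_cos_transform|exact:
    measurable_sin_transform].
under eq_fun do rewrite Im_laplace//.
by apply: measurable_funB; [exact: measurable_cos_transform|exact:
  measurable_sin_transform].
Qed.

(** Each of the two terms integrates to at most the integral over the symmetric
interval, the second one after the reflection [w |-> - w]. *)
Lemma integral_symmetrize_le {R : realType} (N : R -> R) (eta : R) :
  measurable_fun setT N -> (forall w, 0 <= N w) ->
  (\int[leb R]_(w in `[0%R, eta]) (2^-1 * (N w + N (- w)))%:E <=
   \int[leb R]_(w in `[(- eta)%R, eta]) (N w)%:E)%E.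
Proof.
move=> mN N0; pose mu := leb R.
have mNE : measurable_fun setT (EFin \o N) by exact/measurable_EFinP.
have mNN : measurable_fun setT (fun w : R => (N (- w))%:E).
  by apply/measurable_EFinP; apply: (measurableT_comp mN).
set B := (leRHS).
have sub : (`[0, eta]%classic : set R) `<=` `[- eta, eta]%classic.
  move=> w /=; rewrite !in_itv/= => /andP[w0 we]; rewrite we andbT.
  by rewrite (le_trans _ w0)// oppr_le0 (le_trans w0).
have hp : (\int[mu]_(w in `[0%R, eta]) (N w)%:E <= B)%E.
  apply: ge0_subset_integral => //; first exact: measurable_funTS.
  by move=> w _; rewrite lee_fin.
have hn : (\int[mu]_(w in `[0%R, eta]) (N (- w))%:E <= B)%E.
  apply: (@le_trans _ _ (\int[mu]_(w in `[(- eta)%R, eta]) (N (- w))%:E)%E).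
    apply: ge0_subset_integral => //; first exact: measurable_funTS.
    by move=> w _; rewrite lee_fin.
  rewrite /B integral_mkcond [leRHS]integral_mkcond.
  rewrite -[leRHS](ge0_integral_reflect 0); last 2 first.
  - apply/(measurable_restrictT _ _).1 => //; exact: measurable_funTS.
  - by move=> w; rewrite patchE; case: ifP => // _; rewrite lee_fin.
  rewrite le_eqVlt; apply/orP; left; apply/eqP; apply: eq_integral => w _.
  rewrite !patchE sub0r !mem_setE !in_itv/= lerN2 lerNl andbC.
  by [].
under eq_integral do rewrite EFinM EFinD.
rewrite ge0_integralZl//; last 2 first.
- by apply: emeasurable_funD; exact: measurable_funTS.
- by move=> w _; rewrite adde_ge0// lee_fin.
rewrite ge0_integralD//; last 4 first.
- by move=> w _; rewrite lee_fin.
- exact: measurable_funTS.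
- by move=> w _; rewrite lee_fin.
- exact: measurable_funTS.
apply: (@le_trans _ _ (2^-1%:E * (B + B))%E).
  by rewrite lee_wpmul2l// leeD.
have B0 : (0 <= B)%E by apply: integral_ge0 => w _; rewrite lee_fin.
move: B0; clearbody B; move: B {hp hn} => [r| |]//= _; last by rewrite leey.
by rewrite -EFinD -EFinM lee_fin; lra.
Qed.

(** * Smallness of the Fejer means *)

Lemma integrable_norm1 {R : realType} (D : set R) (F : R -> R[i]) :
  measurable D -> cintegrable D F ->
  (leb R).-integrable D (fun w => (norm1 (F w))%:E).
Proof.
move=> mD [ir ii].
have := @integrableD _ (measurableTypeR R) R (leb R) D mD _ _
  (integrable_norm (f := fun w : measurableTypeR R => complex.Re (F w)) ir)
  (integrable_norm (f := fun w : measurableTypeR R => complex.Im (F w)) ii).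
exact: eq_integrable.
Qed.

(** Absolute continuity of the integral of the boundary function. *)
Lemma small_symmetric_mass {R : realType} (F : R -> R[i]) (delta eps : R) :
  0 < delta -> 0 < eps -> cintegrable `]0 - delta, 0 + delta[ F ->
  exists eta : R, [/\ 0 < eta, eta < delta &
    (\int[leb R]_(w in `[(- eta)%R, eta]) (norm1 (F w))%:E <= eps%:E)%E].
Proof.
move=> delta0 eps0 iF; set I : set R := `]0 - delta, 0 + delta[%classic in iF *.
have mI : measurable I by exact: measurable_itv.
have iN := integrable_norm1 I F mI iF.
have iNI : (leb R).-integrable setT (EFin \o ((fun w => norm1 (F w)) \_ I)).
  by rewrite -restrict_EFin; exact: ((@integrable_mkcond _ (measurableTypeR R)
    R (leb R) I (EFin \o (fun w => norm1 (F w))) mI).1 iN).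
have [d [d0 hd]] := integral_normr_continuous iNI eps0.
(* The symmetric interval has length [2 eta], which has to be less than [d]. *)
pose eta := Num.min (delta / 2) (d / 4).
have eta0 : 0 < eta by rewrite lt_min !divr_gt0.
have etad : eta < delta by rewrite gt_min ltr_pdivrMr// ltr_pMr// ltr1n.
have sub : (`[- eta, eta]%classic : set R) `<=` I.
  move=> w; rewrite /I /= !in_itv/= => /andP[w1 w2]; lra.
exists eta; split => //.
have := hd `[- eta, eta]%classic (measurable_itv _).
have eta4 : eta <= d / 4 by rewrite ge_min lexx orbT.
have etad2 : (lebesgue_measure (`[(- eta)%R, eta]%classic : set R) < d%:E)%E.
  by rewrite lebesgue_measure_itv/= lte_fin gtrN// -EFinD lte_fin opprK; lra.
move=> /(_ etad2)/ltW; rewrite -lee_fin; apply: le_trans.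
have iJ : (leb R).-integrable `[- eta, eta] (fun w => (norm1 (F w))%:E).
  by apply: integrableS iN.
rewrite (@eq_Rintegral _ (measurableTypeR R) _ _ _ (fun w => norm1 (F w)));
  last first.
  move=> w wJ; rewrite patchE ifT; first by rewrite ger0_norm// norm1_ge0.
  by apply/mem_set/sub/set_mem.
by rewrite /Rintegral fineK// integrable_fin_num.
Qed.

(** A bound on the damped transforms that is uniform along [s n] survives the
limit [s n --> 0], because the damped convolutions converge. *)
Lemma fejer_mean_le {R : realType} (a : R -> R) (M eta B x : R) (s : nat -> R) :
  0 < eta -> (forall n, 0 < s n) -> s n @[n --> \oo] --> 0 ->
  measurable_fun setT a ->
  {ae leb R, forall u, `|a u| <= M} ->
  (forall n, (\int[leb R]_(w in `[0%R, eta])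
    (`|cos_transform (damped a (s n)) w| +
      `|sin_transform (damped a (s n)) w|)%:E <= B%:E)%E) ->
  `|(\int[leb R]_u (fejer eta (x - u) * damped a 0 u))%R| <= 2 * eta * B.
Proof.
move=> eta0 s0 scvg ma aM hB.
have lim := cvg_fejer_damped a M eta x s eta0 s0 scvg ma aM.
apply: (cvgr_to_le (cvg_norm lim)); apply: nearW => n.
have iq := integrable_damped a M (s n) (s0 n) ma aM.
rewrite -lee_fin (le_trans (fejer_convolution_le eta x _ eta0 iq))//.
by rewrite [leRHS]EFinM lee_wpmul2l// lee_fin mulr_ge0// ltW.
Qed.

(** Triangle inequality through the boundary function [F]: the factor [3] is [2]
for the comparison of the sum norm with the modulus in the error term, and [1]
for [F] itself. *)
Lemma laplace_symmetric_mass_le {R : realType} (psi F : R -> R[i])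
    (I : set R) (s eta eps : R) :
  measurable I -> `[(- eta), eta]%classic `<=` I ->
  (leb R).-integrable setT (EFin \o damped (fun u => complex.Re (psi u)) s) ->
  (leb R).-integrable setT (EFin \o damped (fun u => complex.Im (psi u)) s) ->
  cintegrable I F ->
  (\int[leb R]_(y in I) (normc (laplace psi (s +i* y) - F y))%:E <= eps%:E)%E ->
  (\int[leb R]_(w in `[(- eta)%R, eta]) (norm1 (F w))%:E <= eps%:E)%E ->
  (\int[leb R]_(w in `[0%R, eta])
   (2^-1 * (norm1 (laplace psi (s +i* w)) +
     norm1 (laplace psi (s +i* (- w)))))%:E <= (3 * eps)%:E)%E.
Proof.
move=> mI sub ir ii [iFr iFi] hL hF.
have [mLr mLi] := cmeasurable_laplace psi s ir ii.
have mN := measurable_norm1 setT _ (conj mLr mLi).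
have mFr : measurable_fun I (fun w => complex.Re (F w)).
  by apply/measurable_EFinP; exact: (measurable_int _ iFr).
have mFi : measurable_fun I (fun w => complex.Im (F w)).
  by apply/measurable_EFinP; exact: (measurable_int _ iFi).
have mLF : measurable_fun I (fun w => normc (laplace psi (s +i* w) - F w)).
  apply: measurable_normc; split.
    rewrite (_ : (fun w => _) = (fun w =>
      complex.Re (laplace psi (s +i* w)) - complex.Re (F w))).
      by apply: measurable_funB => //; exact: measurable_funTS.
    by apply/funext => w; case: (laplace _ _) => ? ?; case: (F w).
  rewrite (_ : (fun w => _) = (fun w =>
    complex.Im (laplace psi (s +i* w)) - complex.Im (F w))).
    by apply: measurable_funB => //; exact: measurable_funTS.
  by apply/funext => w; case: (laplace _ _) => ? ?; case: (F w).
have mF1 : measurable_fun I (fun w => norm1 (F w)) by exact: measurable_norm1.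
have n0 (z : R[i]) : 0 <= normc z.
  by case: z => ? ? /=; rewrite sqrtr_ge0.
apply: (le_trans (integral_symmetrize_le _ eta mN (fun w => norm1_ge0 _))).
pose J := `[- eta, eta]%classic : set R.
have mJ : measurable J by exact: measurable_itv.
have mLFJ : measurable_fun J (fun w =>
  (normc (laplace psi (s +i* w) - F w))%:E).
  by apply/measurable_EFinP; exact: measurable_funS mLF.
have mF1J : measurable_fun J (fun w => (norm1 (F w))%:E).
  by apply/measurable_EFinP; exact: measurable_funS mF1.
apply: (@le_trans _ _ (\int[leb R]_(w in J)
    (2%:E * (normc (laplace psi (s +i* w) - F w))%:E + (norm1 (F w))%:E))%E).
  apply: ge0_le_integral => //.
  - by move=> w _; rewrite lee_fin norm1_ge0.
  - by apply/measurable_EFinP; exact: measurable_funTS.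
  - by apply: emeasurable_funD => //; exact: measurable_funeM.
  - move=> w _; rewrite -EFinM -EFinD lee_fin.
    rewrite -{1}(subrK (F w) (laplace psi _)) (le_trans (norm1D _ _))// lerD2r.
    exact: norm1_le_normc.
rewrite ge0_integralD//; last 3 first.
- by move=> w _; rewrite mule_ge0// lee_fin.
- exact: measurable_funeM.
- by move=> w _; rewrite lee_fin norm1_ge0.
rewrite ge0_integralZl//; last by move=> w _; rewrite lee_fin.
rewrite (_ : (3 * eps)%:E = (2%:E * eps%:E + eps%:E)%E); last first.
  by rewrite -EFinM -EFinD; congr EFin; ring.
apply: leeD => //.
rewrite lee_wpmul2l//; apply: le_trans hL.
apply: ge0_subset_integral => //; first exact/measurable_EFinP.
by move=> w _; rewrite lee_fin.
Qed.

(** The gain over the trivial bound is that [eps] is arbitrary while the mass of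
[fejer eta] is comparable to [eta]. *)
Lemma small_fejer_mean {R : realType} (psi : R -> R[i]) (eps : R) :
  Linfty psi -> H1_boundary_behavior (laplace psi) 0 -> 0 < eps ->
  exists2 eta : R, 0 < eta & forall x,
    `|(\int[leb R]_u
        (fejer eta (x - u) * damped (fun u =>
          complex.Re (psi u)) 0 u))%R| <= eta * eps /\
    `|(\int[leb R]_u
        (fejer eta (x - u) * damped (fun u =>
          complex.Im (psi u)) 0 u))%R| <= eta * eps.
Proof.
move=> psiL [delta [delta0]]; set I : set R := `]0 - delta, 0 + delta[%classic.
move=> [F [iF [_ cvgF]]] eps0.
have mI : measurable I by exact: measurable_itv.
have eps6 : 0 < eps / 6 by rewrite divr_gt0.
(* A sixth, because [laplace_symmetric_mass_le] loses the factor [3] and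
   [fejer_mean_le] the factor [2]. *)
have [eta [eta0 etad hF]] := small_symmetric_mass F delta (eps / 6) delta0 eps6
  iF.
have [M psiM] := Linfty_bound psi psiL.
have [[mr mi] _] := psiL.
have rM : {ae leb R, forall u, `|complex.Re (psi u)| <= M}.
  apply: (ae_imply psiM) => u.
  by apply: le_trans; exact: normr_Re_le_normc.
have iM : {ae leb R, forall u, `|complex.Im (psi u)| <= M}.
  apply: (ae_imply psiM) => u.
  by apply: le_trans; exact: normr_Im_le_normc.
have sub : (`[- eta, eta]%classic : set R) `<=` I.
  move=> w; rewrite /I /= !in_itv/= => /andP[w1 w2]; lra.
have [e e0 he] : exists2 e : R, 0 < e & forall s, 0 < s -> s < e ->
  (\int[leb R]_(y in I) (normc (laplace psi (s +i* y) - F y))%:E <=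
    (eps / 6)%:E)%E.
  have lt0 : ereal_nbhs 0%E [set y : \bar R | (y < (eps / 6)%:E)%E].
    by apply: open_ereal_lt'; rewrite lte_fin.
  have /nbhs_ballP[e /= e0 he] := cvgF _ lt0.
  exists e => // s s0 se; apply/ltW/he => //=.
  by rewrite /ball/= sub0r normrN gtr0_norm.
(* Every term lies in the range where the error term is already small. *)
pose s n := e / 2 * n.+1%:R^-1.
have s0 n : 0 < s n by rewrite mulr_gt0// ?divr_gt0// invr_gt0.
have se n : s n < e.
  rewrite /s (@le_lt_trans _ _ (e / 2))//;
    last by rewrite ltr_pdivrMr// ltr_pMr// ltr1n.
  by rewrite ler_piMr ?invf_le1 ?ler1n ?divr_ge0 ?(ltW e0).
have scvg : s n @[n --> \oo] --> 0.
  rewrite -[X in _ --> X](mulr0 (e / 2)).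
  by apply: cvgM; [exact: cvg_cst|exact: cvg_harmonic].
have ir n := integrable_damped _ M _ (s0 n) mr rM.
have ii n := integrable_damped _ M _ (s0 n) mi iM.
have mass n := laplace_symmetric_mass_le psi F I (s n) eta (eps / 6) mI sub
  (ir n) (ii n) iF (he _ (s0 n) (se n)) hF.
have key n w := cos_sin_transform_le_laplace psi (s n) w (ir n) (ii n).
have E : eta * eps = 2 * eta * (3 * (eps / 6)) by field.
have mT (q : R -> R) : measurable_fun setT q ->
    measurable_fun `[0, eta] (fun w =>
      (`|cos_transform q w| + `|sin_transform q w|)%:E).
  move=> mq; apply/measurable_EFinP; apply: measurable_funTS.
  apply: measurable_funD; apply: measurableT_comp => //.
    exact: measurable_cos_transform.
  exact: measurable_sin_transform.
have mNN n : measurable_fun setT (fun w =>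
  (2^-1 * (norm1 (laplace psi (s n +i* w)) +
    norm1 (laplace psi (s n +i* (- w)))))%:E).
  apply/measurable_EFinP; apply: measurable_funM => //.
  have mN := measurable_norm1 setT _ (cmeasurable_laplace psi (s n) (ir n) (ii
    n)).
  by apply: measurable_funD => //; exact: (measurableT_comp mN).
exists eta => // x; rewrite E; split.
  apply: (fejer_mean_le _ M _ _ _ s) => // n; apply: le_trans (mass n).
  apply: ge0_le_integral => //.
  - by apply: mT; exact: measurable_damped.
  - exact: (measurable_funTS (mNN n)).
  - by move=> w _; rewrite lee_fin; exact: (key n w).1.
apply: (fejer_mean_le _ M _ _ _ s) => // n; apply: le_trans (mass n).
apply: ge0_le_integral => //.
- by apply: mT; exact: measurable_damped.
- exact: (measurable_funTS (mNN n)).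
- by move=> w _; rewrite lee_fin; exact: (key n w).2.
Qed.

(** * Almost convergence *)

(** Once the substitution [u = x - t] has moved the translation onto the kernel,
the half line [u < 0], where [a] vanishes almost everywhere, can be cut off. *)
Lemma fejer_convolution_damped {R : realType} (a : R -> R) (M eta c x : R) :
  0 < eta -> measurable_fun setT a ->
  {ae leb R, forall u, `|a u| <= M} ->
  {ae leb R, forall u, u < 0 -> a u = 0} ->
  (\int[leb R]_t (c * fejer eta t * a (x - t)))%R =
  c * (\int[leb R]_u (fejer eta (x - u) * damped a 0 u))%R.
Proof.
move=> eta0 ma aM aneg; pose mu := leb R.
have mK : measurable_fun setT (fun u : R => fejer eta (x - u)).
  exact: (measurableT_comp (measurable_fejer eta) (measurable_reflect x)).
have iK := integrable_reflect x _ (integrable_fejer _ eta0).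
have iKa : mu.-integrable setT (fun u : R => (fejer eta (x - u) * a u)%:E).
  exact: (integrable_ae_bounded_mul _ _ M iK ma aM).
transitivity (\int[mu]_u (c * (fejer eta (x - u) * a u)))%R.
  rewrite -[RHS](Rintegral_reflect x); last first.
    by do 2 apply: measurable_funM => //.
  by apply: eq_Rintegral => t _; rewrite subKr mulrA.
rewrite RintegralZl//; congr (c * _); congr fine.
apply: ae_eq_integral => //.
- by apply/measurable_EFinP; apply: measurable_funM.
- apply/measurable_EFinP; apply: measurable_funM => //;
    exact: measurable_damped.
apply: (ae_imply aneg) => u au _.
congr EFin; congr (_ * _); rewrite /damped indicE mem_setE in_itv/= andbT.
by case: leP => [u0|/au ->]; rewrite /= mul0r// oppr0 expR0 !mul1r.
Qed.

(** The density is the normalized Fejer kernel at a sufficiently small scale. *)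
Lemma convolution_fejer_le {R : realType} (psi : R -> R[i]) (eps : R) :
  Linfty psi ->
  {ae leb R, forall t : R, t < 0 -> psi t = 0} ->
  H1_boundary_behavior (laplace psi) 0 -> 0 < eps ->
  exists f : R -> R[i], [/\ cintegrable setT f,
    {ae leb R, forall x, 0 <= f x}, cintegral setT f = 1,
    Linfty (convolution f psi) & (Linfty_norm (convolution f psi) <= eps%:E)%E].
Proof.
move=> psiL psi0 H1 eps0.
pose c0 : R := (1 - cos 1) / 2; have c00 : 0 < c0 := fejer_mass_const_gt0.
(* The mass constant [c0] is lost in the normalization, and the factor [2] in
   adding the real and the imaginary part. *)
have e0 : 0 < eps * c0 / 2 by rewrite divr_gt0// mulr_gt0.
have [eta eta0 heta] := small_fejer_mean psi _ psiL H1 e0.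
pose m := (\int[leb R]_t fejer eta t)%R.
have mge : eta * c0 <= m := fejer_mass_ge eta eta0.
have m0 : 0 < m by apply: lt_le_trans mge; rewrite mulr_gt0.
have [M psiM] := Linfty_bound psi psiL.
have [[mr mi] _] := psiL.
have rM : {ae leb R, forall u, `|complex.Re (psi u)| <= M}.
  apply: (ae_imply psiM) => u.
  by apply: le_trans; exact: normr_Re_le_normc.
have iM : {ae leb R, forall u, `|complex.Im (psi u)| <= M}.
  apply: (ae_imply psiM) => u.
  by apply: le_trans; exact: normr_Im_le_normc.
have r0 : {ae leb R, forall u : R, u < 0 -> complex.Re (psi u) = 0}.
  apply: (ae_imply psi0) => u.
  by move=> /[apply] ->.
have i0 : {ae leb R, forall u : R, u < 0 -> complex.Im (psi u) = 0}.
  apply: (ae_imply psi0) => u.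
  by move=> /[apply] ->.
pose f (t : R) : R[i] := (m^-1 * fejer eta t)%:C.
have ReE x : complex.Re (convolution f psi x) = m^-1 *
    (\int[leb R]_u (fejer eta (x - u) * damped (fun u =>
      complex.Re (psi u)) 0 u))%R.
  rewrite -(fejer_convolution_damped _ M _ _ _ eta0 mr rM r0).
  by apply: eq_Rintegral => t _; rewrite /f /=; case: (psi _) => p q /=;
    rewrite mul0r subr0.
have ImE x : complex.Im (convolution f psi x) = m^-1 *
    (\int[leb R]_u (fejer eta (x - u) * damped (fun u =>
      complex.Im (psi u)) 0 u))%R.
  rewrite -(fejer_convolution_damped _ M _ _ _ eta0 mi iM i0).
  by apply: eq_Rintegral => t _; rewrite /f /=; case: (psi _) => p q /=;
    rewrite mul0r addr0.
have small (y : R) : `|y| <= eta * (eps * c0 / 2) -> `|m^-1 * y| <= eps / 2.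
  move=> hy; rewrite normrM (gtr0_norm (_ : 0 < m^-1)) ?invr_gt0// [leLHS]mulrC
    ler_pdivrMr//.
  rewrite (le_trans hy)// (_ : _ * _ = eps / 2 * (eta * c0)); last by field.
  by rewrite ler_wpM2l// divr_ge0// ltW.
have nle x : normc (convolution f psi x) <= eps.
  rewrite (le_trans (normc_le_norm1 _))// /norm1 ReE ImE (splitr eps).
  by have [h1 h2] := heta x; rewrite lerD// small.
have nE := Linfty_norm_le (convolution f psi) eps (ltW eps0) nle.
have mconv (a : R -> R) : measurable_fun setT a ->
  measurable_fun setT (fun x : R => m^-1 *
    (\int[leb R]_u (fejer eta (x - u) * damped a 0 u))%R).
  move=> ma; apply: measurable_funM => //.
  apply: (@measurable_Rintegral_param R (fun z =>
    fejer eta (z.1 - z.2) * damped a 0 z.2)).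
  apply: measurable_funM.
    by apply: (measurableT_comp (measurable_fejer eta)); apply: measurable_funB.
  by apply: (measurableT_comp (measurable_damped a 0 ma)).
exists f; split => //.
- split => /=.
    exact: (integrableZl measurableT m^-1 (integrable_fejer eta eta0)).
  exact: integrable0.
- by apply: nearW => t; rewrite /f lecE/= eqxx/= mulr_ge0 ?invr_ge0
    ?fejer_ge0// ltW.
- rewrite /cintegral /f/=; congr (_ +i* _).
    rewrite RintegralZl//; last exact: integrable_fejer.
    by rewrite mulVf// gt_eqF.
  by rewrite /Rintegral integral0.
- split; last by rewrite (le_lt_trans nE)// ltry.
  split.
    by under eq_fun do rewrite ReE; exact: mconv.
  by under eq_fun do rewrite ImE; exact: mconv.
Qed.

Theorem theorem8p6 (R : realType) (psi : R -> R[i])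
  (psi_Linfty : Linfty psi)
  (psi_neg : {ae @lebesgue_measure R, forall t : R, t < 0 -> psi t = 0})
  (psi_H1 : H1_boundary_behavior (laplace psi) 0) :
  almost_convergent psi 0.
Proof.
move=> phi [[_ [M phiM]] _ _] phi_inv.
apply/eq0_normc/eqP; rewrite eq_le; apply/andP; split; last first.
  by case: (phi psi) => ? ? /=; rewrite sqrtr_ge0.
apply/ler_addgt0Pl => e e0; rewrite addr0.
have e'0 : 0 < e / (`|M| + 1) by rewrite divr_gt0// ltr_wpDl.
have [f [fi f0 f1 fL fe]] := convolution_fejer_le psi _ psi_Linfty psi_neg
  psi_H1 e'0.
rewrite -(phi_inv f psi psi_Linfty fi f0 f1) -lee_fin.
apply: (le_trans (phiM _ fL)).
apply: (@le_trans _ _ (`|M|%:E * (e / (`|M| + 1))%:E)%E).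
  apply: (@le_trans _ _ (`|M|%:E * Linfty_norm (convolution f psi))%E).
    by rewrite lee_wpmul2r ?Linfty_norm_ge0// lee_fin ler_norm.
  by rewrite lee_wpmul2l// lee_fin.
rewrite -EFinM lee_fin mulrA ler_pdivrMr ?ltr_wpDl//.
by rewrite mulrC ler_pM2l// lerDl.
Qed.
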